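(* Let $M$ be a one-tape deterministic Turing machine, $C_t$ the $t$-th configuration of $M$ on a given instance, and $B$ the characteristic tensor of $M$. Suppose $A_1$ is an order-4 tensor such that $A_1|_{k\ne 0}=A(C_1)$, and define $A_{t+1}=A_t\times_1 B$ for $t=1,2,\ldots$. Then $A(C_t)=A_t|_{k\ne 0}$ for all $t\ge 1$.
   Context: A one-tape deterministic Turing machine is $M=\langle Q,\Gamma,b,\Sigma,\delta,q_s,F\rangle$ with states $Q=\{q_1(=q_s),q_2,\ldots,q_n\}$, alphabet $\Gamma=\{s_0,s_1,\ldots,s_m\}$ with blank $b=s_0$, and transition function $\delta:\Gamma\times Q\to\Gamma\times Q\times\{-1,1\}$. Tape cells are indexed $1,2,3,\ldots$. For a configuration $C_t$, its characteristic tensor is the order-4 0-1 tensor $A(C_t)=(a_{ij,kl})$ with $a_{ij,kl}=1$ iff the $i$-th cell contains $s_j$, the controller state is $q_k$, and the head points to cell $l$; otherwise $0$. An extra state $q_0$ is introduced, $Q^*=Q\cup\{q_0\}$, and $\delta$ is extended to $\Gamma\times Q^*\to\Gamma\times Q^*\times\{-1,0,1\}$ by $\delta(s,q_0)=(s,q_0,0)$. Write $\delta=(\delta_1,\delta_2,\delta_3)$ for its three components. With $[k]=\{0,1,\ldots,k\}$, the characteristic tensor of $M$ is the order-8 tensor $B=(b^{i_1j_1,k_1l_1}_{i_2j_2,k_2l_2})$, $i_1,i_2,l_1,l_2\in\mathbb{N}^+$, $j_1,j_2\in[m]$, $k_1,k_2\in[n]$, with $b^{i_1j_1,k_1l_1}_{i_2j_2,k_2l_2}=1$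 iff either (1) $k_1\ne0$, $i_1\ne l_1$, $i_2=i_1$, $j_2=j_1$, $k_2=0$, $l_2=l_1$; or (2) $k_1\ne0$, $i_1=l_1$, $i_2=i_1$, $j_2=\delta_1(j_1,k_1)$, $k_2=\delta_2(j_1,k_1)$, $l_2=l_1+\delta_3(j_1,k_1)$; and $0$ otherwise. For an order-4 tensor $A=(a_{ij,kl})$ and an order-8 tensor $B$, the Type I product $C=A\times_1 B$ is the order-4 tensor with $c_{ij,kl}=\left(\sum_{k_2,l_2}a_{i_1j_1,k_1l_1}b^{i_1j_1,k_1l_1}_{ij,k_2l_2}\right)\left(\sum_{i_2,j_2}a_{i_1j_1,k_1l_1}b^{i_1j_1,k_1l_1}_{i_2j_2,kl}\right)$, using Einstein summation over the repeated indices $i_1,j_1,k_1,l_1$. For an order-4 tensor $A$ with $k\in[n]$, $A|_{k\ne0}$ denotes the tensor obtained by deleting entries whose $k$ index is $0$. *)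

(* Defs.v *)
From HB Require Import structures.
From mathcomp Require Import all_boot all_order all_algebra.
From mathcomp Require Import all_classical all_reals all_analysis.

Set Implicit Arguments.
Unset Strict Implicit.
Unset Printing Implicit Defensive.

Import Order.TTheory GRing.Theory Num.Theory.
Local Open Scope ring_scope.

Notation pnat := {i : nat | (0 < i)%N}.

(** [sym m] is Gamma = {s_0, ..., s_m}, with blank s_0 = [ord0].
    [xstate n] is Q^* = {q_0, ..., q_n}, and [state n] is Q = Q^* minus q_0. *)
Notation sym m := 'I_m.+1 (only parsing).

Definition blank (m : nat) : sym m := ord0.

Notation xstate n := 'I_n.+1 (only parsing).

Definition q0 (n : nat) : xstate n := ord0.

Notation state n := {k : xstate n | k != q0 n}.

(** [tm_startE] says that the initial state is q_1, hence forces [0 < n]. *)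
Record turing (m n : nat) := Turing {
  tm_input : {set sym m};
  tm_delta : sym m * state n -> sym m * state n * int;
  tm_start : state n;
  tm_final : {set state n};
  tm_deltaP : forall x, (tm_delta x).2 = -1 \/ (tm_delta x).2 = 1;
  tm_startE : nat_of_ord (val tm_start) = 1%N
}.

Record config (m n : nat) := Config {
  tape : pnat -> sym m;
  ctrl : state n;
  head : pnat
}.

(** Input on cells 1, ..., [size w], blanks elsewhere, head on cell 1. *)
Definition init_config (m n : nat) (M : turing m n) (w : seq (sym m)) :
    config m n :=
  Config (fun i : pnat => nth (blank m) w (val i).-1) (tm_start M)
         (exist _ 1%N isT).

(** The sum below is never negative, so the absolute value only converts it to
    [nat]; there is no successor exactly when the head would leave the tape to
    the left of cell 1. As delta is total on Gamma x Q, the final states do not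
    block the step: if the run is cut at a final state, its configurations are
    an initial segment of the sequence obtained here. *)
Definition step (m n : nat) (M : turing m n) (c : config m n) :
    option (config m n) :=
  let: (s, q, d) := tm_delta M (tape c (head c), ctrl c) in
  omap (Config (fun i => if i == head c then s else tape c i) q)
       (insub (absz ((val (head c))%:Z + d)) : option pnat).

(** The [t]-th configuration, numbered from [t = 1]; [None] if the run has
    already left the tape. The value at [t = 0] is meaningless. *)
Definition config_at (m n : nat) (M : turing m n) (w : seq (sym m)) (t : nat) :
    option (config m n) :=
  iter t.-1 (obind (step M)) (Some (init_config M w)).

(** The extension of delta to Gamma x Q^*. *)
Definition delta_ext (m n : nat) (M : turing m n) (s : sym m) (k : xstate n) :
    sym m * xstate n * int :=
  if (insub k : option (state n)) is Some q then
    let: (s', q', d) := tm_delta M (s, q) in (s', val q', d)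
  else (s, q0 n, 0).

(** Entries are extended reals: the tape is infinite, so entries of a product
    with state index 0 may be infinite sums. [K] is the range of the state
    index: [state n] for configurations, [xstate n] for products. *)
Definition tensor4 (R : realType) (m : nat) (K : Type) : Type :=
  pnat -> sym m -> K -> pnat -> \bar R.

(** The first four arguments are the upper indices, the last four the lower
    ones. *)
Definition tensor8 (R : realType) (m : nat) (K : Type) : Type :=
  pnat -> sym m -> K -> pnat -> tensor4 R m K.

Definition char_config (R : realType) (m n : nat) (c : config m n) :
    tensor4 R m (state n) :=
  fun i j k l => ([&& tape c i == j, ctrl c == k & head c == l]%:R)%:E.

Definition char_tm (R : realType) (m n : nat) (M : turing m n) :
    tensor8 R m (xstate n) :=
  fun i1 j1 k1 l1 i2 j2 k2 l2 =>
    let: (d1, d2, d3) := delta_ext M j1 k1 in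
    (([&& k1 != q0 n, i1 != l1, i2 == i1, j2 == j1, k2 == q0 n & l2 == l1]
      || [&& k1 != q0 n, i1 == l1, i2 == i1, j2 == d1, k2 == d2
           & (val l2)%:Z == (val l1)%:Z + d3])%:R)%:E.

(** Unordered sum of a family of either sign; it is meaningful unless both
    parts are infinite. *)
Definition total_sum (R : realType) (T : choiceType) (f : T -> \bar R) :
    \bar R :=
  (\esum_(x in [set: T]) (f^\+)%E x - \esum_(x in [set: T]) (f^\- )%E x)%E.

(** Each factor carries its own Einstein summation over i1, j1, k1, l1. *)
Definition prodI (R : realType) (m n : nat)
    (A : tensor4 R m (xstate n)) (B : tensor8 R m (xstate n)) :
    tensor4 R m (xstate n) :=
  fun i j k l =>
    (total_sum (fun x : pnat * sym m * xstate n * pnat * xstate n * pnat =>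
       let: (i1, j1, k1, l1, k2, l2) := x in
       A i1 j1 k1 l1 * B i1 j1 k1 l1 i j k2 l2) *
     total_sum (fun x : pnat * sym m * xstate n * pnat * pnat * sym m =>
       let: (i1, j1, k1, l1, i2, j2) := x in
       A i1 j1 k1 l1 * B i1 j1 k1 l1 i2 j2 k l))%E.

Definition restrict_nz (R : realType) (m n : nat)
    (A : tensor4 R m (xstate n)) : tensor4 R m (state n) :=
  fun i j k l => A i j (val k) l.

(* Main.v *)
(** Multiplication by the tensor of the machine kills the entries with state
    index 0, so a tensor that represents a configuration away from state index 0
    meets only one state and one head position, and along those every cell has a
    single symbol. In the first factor of the product, cell [i] contributes one
    term, carrying its new symbol (the rewritten one under the head). In the
    second factor, a nonzero state index [k] selects the cell under the head,
    whose one term carries the new state and head position. *)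

Require Import Defs.
From HB Require Import structures.
From mathcomp Require Import all_boot all_order all_algebra.
From mathcomp Require Import all_classical all_reals all_analysis.
From mathcomp Require Import zify.

Set Implicit Arguments.
Unset Strict Implicit.
Unset Printing Implicit Defensive.

Import Order.TTheory GRing.Theory Num.Theory.
Local Open Scope ring_scope.

(* Both [Defs] and [seq] define [head]. *)
Local Notation head := Defs.head.

(** Both factors of [prodI] reduce to this form: [x0] is the only index that can contribute, and [b]
    is what remains of its 0-1 term. *)
Lemma total_sum_dirac (R : realType) (T : choiceType) (x0 : T) (b : bool) :
  total_sum (fun x => (((x == x0) && b)%:R : R)%:E) = (b%:R)%:E.
Proof.
pose f x : \bar R := (((x == x0) && b)%:R)%:E.
rewrite /total_sum -/f.
have f0 x : (0 <= f x)%E by rewrite /f lee_fin ler0n.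
have -> : (f^\+)%E = f by apply/funext => x; rewrite funeposE; apply/max_idPl.
have -> : (f^\-)%E = cst 0%E.
  by apply/funext => x; rewrite funenegE; apply/max_idPr; rewrite leeNl oppe0.
rewrite [X in (_ - X)%E]esum1 // sube0.
have <- : \esum_(x in [set x0]) f x = (b%:R)%:E by rewrite esum_set1 // /f eqxx.
rewrite [RHS]esum_mkcond; apply: eq_esum => x _.
case: ifPn => //; rewrite notin_setE /= => /eqP/negPf xx0.
by rewrite /f xx0.
Qed.

Lemma step_Some (m n : nat) (M : turing m n) (c c' : config m n) :
  step M c = Some c' ->
  exists s d,
    [/\ tm_delta M (tape c (head c), ctrl c) = (s, ctrl c', d),
        forall i, tape c' i = if i == head c then s else tape c i &
        (val (head c'))%:Z = (val (head c))%:Z + d].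
Proof.
rewrite /step.
have := tm_deltaP M (tape c (head c), ctrl c).
case: (tm_delta M _) => [[s q] d] /= hd.
case: insubP => //= h _ hE [<-]; exists s, d; split => //=.
(* The head cell is at least 1 and [d] is at least -1, so [absz] leaves the sum unchanged. *)
have := valP (head c); move: hE => /= ->; case: hd => ->; lia.
Qed.

Lemma mul_char_tmE (R : realType) (m n : nat) (M : turing m n)
    (A : tensor4 R m (xstate n)) (c c' : config m n) i1 j1 k1 l1 i2 j2 k2 l2 :
  restrict_nz A = char_config R c -> step M c = Some c' ->
  (A i1 j1 k1 l1 * char_tm R M i1 j1 k1 l1 i2 j2 k2 l2)%E =
  ([&& i1 == i2, j1 == tape c i1, k1 == val (ctrl c), l1 == head c,
       j2 == tape c' i2 &
       (k2, l2) == (if i1 == head c then (val (ctrl c'), head c')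
                    else (q0 n, head c))]%:R)%:E.
Proof.
move=> hA /step_Some[s [d [hM htape hhead]]].
rewrite /char_tm /delta_ext; case: insubP => [q k1N0 qk1|]; last first.
  (* At state index 0 the entry of [A] is arbitrary, possibly infinite, but its product with 0 is
     still 0. *)
  rewrite negbK => /eqP ->; rewrite eqxx /= mule0.
  by rewrite [q0 n == _]eq_sym (negPf (valP (ctrl c))) !andbF.
have -> : A i1 j1 k1 l1 = char_config R c i1 j1 q l1.
  by rewrite -hA /restrict_nz qk1.
rewrite /char_config -qk1 (inj_eq val_inj) (valP q).
rewrite [j1 == _]eq_sym [q == _]eq_sym [l1 == _]eq_sym.
case hM1: (tm_delta M (j1, q)) => [[s1 r1] d1].
case: eqP => [tj|]; last by rewrite mul0e !andbF.
case: eqP => [cq|]; last by rewrite mul0e !andbF.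
case: eqP => [hl|]; last by rewrite mul0e !andbF.
rewrite /= mul1e -hl htape [i2 == _]eq_sym.
have [<-{i2}|] := eqVneq i1 i2; last by rewrite !andbF.
(* Off the head only the first clause of [char_tm] can hold, under the head only the second. *)
have [ih|_] := eqVneq i1 (head c); last by rewrite /= orbF tj xpair_eqE.
move: hM; rewrite -ih tj cq hM1 => -[-> -> ->].
by rewrite /= xpair_eqE ih -hhead.
Qed.

Lemma prodI_step (R : realType) (m n : nat) (M : turing m n)
    (A : tensor4 R m (xstate n)) (c c' : config m n) :
  restrict_nz A = char_config R c -> step M c = Some c' ->
  restrict_nz (prodI A (char_tm R M)) = char_config R c'.
Proof.
move=> hA hc.
apply/funext => i; apply/funext => j; apply/funext => k; apply/funext => l.
rewrite /restrict_nz /prodI /char_config.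
(* The 0-1 entry splits into a tape indicator and a control-and-head indicator, one for each
   factor. *)
rewrite -mulnb natrM EFinM; congr (_ * _)%E.
- pose p := if i == head c then (val (ctrl c'), head c') else (q0 n, head c).
  rewrite -(total_sum_dirac R (i, tape c i, val (ctrl c), head c, p.1, p.2)).
  congr total_sum; apply/funext => -[[[[[i1 j1] k1] l1] k2] l2].
  rewrite (mul_char_tmE _ _ _ _ _ _ _ _ hA hc) !xpair_eqE [j == _]eq_sym.
  have [->|//] := eqVneq i1 i; rewrite -/p [p]surjective_pairing xpair_eqE /=.
  by congr (_%:R%:E); do !case: (_ == _).
- rewrite -(total_sum_dirac R (head c, tape c (head c), val (ctrl c), head c,
                               head c, tape c' (head c))).
  congr total_sum; apply/funext => -[[[[[i1 j1] k1] l1] i2] j2].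
  rewrite (mul_char_tmE _ _ _ _ _ _ _ _ hA hc) !xpair_eqE.
  (* A cell off the head yields the lower state index 0, which [k] excludes. *)
  have [->|] := eqVneq i1 (head c); last first.
    by rewrite xpair_eqE (negPf (valP k)) !andbF.
  rewrite xpair_eqE (inj_eq val_inj) [k == _]eq_sym [l == _]eq_sym.
  rewrite [head c == i2]eq_sym.
  have [->|] := eqVneq i2 (head c); last by rewrite !andbF.
  by congr (_%:R%:E); do !case: (_ == _).
Qed.

Theorem theorem1 (R : realType) (m n : nat) (M : turing m n)
    (w : seq (sym m)) (hw : {in w, forall s, s \in tm_input M})
    (A : nat -> tensor4 R m (xstate n))
    (hA1 : restrict_nz (A 1%N) = char_config R (init_config M w))
    (hA : forall t, (1 <= t)%N -> A t.+1 = prodI (A t) (char_tm R M)) :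
  forall (t : nat) (c : config m n), (1 <= t)%N ->
    config_at M w t = Some c -> char_config R c = restrict_nz (A t).
Proof.
case=> // t c _; elim: t c => [|t IHt] c; first by case=> <-.
(* A run still defined at the later time has a configuration [c0] one step before, to which the
   induction hypothesis applies. *)
rewrite /config_at /=; case E: (iter t _ _) => [c0|] //= hc.
by rewrite hA //; apply/esym/(prodI_step _ hc)/esym/IHt.
Qed.
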